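(* Let $g(S)=\sum_{j=p}^{q}c_jS^j\in\mathbb K[S,S^{-1}]$, $\lambda\in\mathbb K$, $H=2(X+g)D-\lambda$, and for $n\ge0$ let $p_n$ be the unique monic degree-$n$ polynomial in $\mathbb K[x]$ with $Hp_n=(2n-\lambda)p_n$. Then every $p_n$ satisfies $$x\bigl(p_n(x)-p_n(x-1)\bigr)+\sum_{j=p}^{q}c_j\bigl(p_n(x+j+1)-p_n(x+j)\bigr)=np_n(x).$$ This spectral equation is independent of $\lambda$. Conversely, for every $\mathfrak{sl}_2$-triple $(E,H,1-S)$ in $\mathcal A$, the associated monic polynomial eigenbasis of $H$ satisfies the displayed equation for the unique Laurent polynomial recovered from $H$ by $$g(S)=\sum_jc_jS^j=\frac{R_H(S)-R_H(1)}{2(S-1)},\qquad R_H=H-(2x-2xS^{-1})\in\mathbb K[S,S^{-1}].$$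
   Context: $\mathbb K$ is a field of characteristic zero. $\mathcal A=\mathbb K[x]\langle S,S^{-1}\rangle/(Sx-(x+1)S)$ consists of finite sums $\sum_jt_j(x)S^j$ ($j\in\mathbb Z$, $t_j\in\mathbb K[x]$) and acts on $\mathbb K[x]$ by $(Sf)(x)=f(x+1)$; $D=S-1$, $X=xS^{-1}$. An $\mathfrak{sl}_2$-triple $(E,H,F)$ satisfies $[H,E]=2E$, $[H,F]=-2F$, $[E,F]=H$. The triples with $F=1-S$ are exactly those with $H=2(X+g)D-\lambda$, $E=(X+g)^2D-\lambda(X+g)$ for unique $g\in\mathbb K[S,S^{-1}]$, $\lambda\in\mathbb K$; the associated monic eigenbasis consists of the unique monic degree-$n$ polynomials $p_n$ with $Hp_n=(2n-\lambda)p_n$. $R_H(1)$ denotes the value of the Laurent polynomial $R_H$ at $S=1$. *)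

(* Defs.v *)
From HB Require Import structures.
From mathcomp Require Import all_boot all_order all_algebra.
From mathcomp Require Import finmap.
From mathcomp.multinomials Require Import monalg.

Set Implicit Arguments.
Unset Strict Implicit.
Unset Printing Implicit Defensive.

Import Order.TTheory GRing.Theory Num.Theory.
Local Open Scope fset_scope.
Local Open Scope ring_scope.

(* The integers p, p + 1, ..., q (none if q < p). *)
Definition int_range (p q : int) : seq int :=
  [seq p + k%:Z | k <- iota 0 `|(Num.max 0 (q + 1 - p))%R|%N].

Lemma mem_int_range (p q j : int) : (j \in int_range p q) = (p <= j <= q).
Proof.
have Hz : (`|(Num.max 0 (q + 1 - p))%R|%N : int) = Num.max 0 (q + 1 - p).
  by rewrite gez0_abs // le_max lexx.
apply/mapP/idP => [[k]|/andP[pj jq]].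
  rewrite mem_iota add0n => /andP[_ hk] ->.
  rewrite lerDl lez_nat leq0n /= -ltzD1.
  move: hk; rewrite -ltz_nat Hz lt_max ltz_nat ltn0 /=.
  by rewrite ltrBrDl.
exists `|j - p|%N; last by rewrite gez0_abs ?subr_ge0 // subrKC.
rewrite mem_iota add0n /= -ltz_nat Hz gez0_abs ?subr_ge0 //.
by rewrite lt_max orbC ltrD2r ltzD1 jq.
Qed.

Lemma int_range_uniq (p q : int) : uniq (int_range p q).
Proof. by rewrite map_inj_uniq ?iota_uniq // => i j /addrI []. Qed.

(* The algebra K[x]<S, S^-1> / (S x - (x + 1) S) in normal form: a is the
   finitely supported family of its coefficients t_j = a@_j in K[x], standing
   for the finite sum of the t_j(x) S^j.  The type is an alias of {malg _} so
   that it carries the twisted product below and no other. *)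
Definition skewLaurent (K : fieldType) : Type := {malg {poly K}[int]}.
HB.instance Definition _ (K : fieldType) :=
  GRing.Zmodule.copy (skewLaurent K) {malg {poly K}[int]}.

Section ZmodMorphism.
Variables (U V : zmodType) (F : U -> V).
Hypothesis FB : zmod_morphism F.

Lemma zmod_morph0 : F 0 = 0.
Proof. by rewrite -(subrr 0) FB subrr. Qed.

Lemma zmod_morphD : {morph F : x y / x + y}.
Proof.
move=> x y; have FN z : F (- z) = - F z by rewrite -sub0r FB zmod_morph0 sub0r.
by rewrite -[y in LHS]opprK FB FN opprK.
Qed.

End ZmodMorphism.

Section SkewLaurent.
Variable K : fieldType.
Implicit Types (t u f : {poly K}) (a b c : skewLaurent K) (i j : int).

(* (S^j f)(x) = f(x + j) *)
Definition shift j f : {poly K} := f \Po ('X + (j%:~R)%:P).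

Lemma shift_additive j : zmod_morphism (shift j).
Proof. by move=> f g; rewrite /shift comp_polyB. Qed.
HB.instance Definition _ j :=
  GRing.isZmodMorphism.Build {poly K} {poly K} (shift j) (shift_additive j).

Lemma shift_multiplicative j : monoid_morphism (shift j).
Proof. by split=> [|f g]; rewrite /shift ?comp_polyM ?comp_polyC. Qed.
HB.instance Definition _ j :=
  GRing.isMonoidMorphism.Build {poly K} {poly K} (shift j)
    (shift_multiplicative j).

Lemma shift0 f : shift 0 f = f.
Proof. by rewrite /shift addr0 comp_polyXr. Qed.

Lemma shiftD i j f : shift i (shift j f) = shift (i + j) f.
Proof.
rewrite /shift -comp_polyA comp_polyD comp_polyX comp_polyC.
by rewrite rmorphD /= polyCD -addrA.
Qed.

Definition monom t j : skewLaurent K := << t *g j >>.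

Lemma monomB j : zmod_morphism (monom^~ j).
Proof. by move=> t u; rewrite /monom monalgUB. Qed.

Section LinearExtension.
Variables (V : zmodType) (F : int -> {poly K} -> V).
Hypothesis FB : forall i, zmod_morphism (F i).

Definition lin_ext a : V := \sum_(i <- msupp a) F i a@_i.

Lemma lin_extw (d : {fset int}) a :
  msupp a `<=` d -> lin_ext a = \sum_(i <- d) F i a@_i.
Proof.
move=> le; apply: big_fset_incl => // i _ /mcoeff_outdom ->; exact: zmod_morph0.
Qed.

Lemma lin_ext_additive : zmod_morphism lin_ext.
Proof.
move=> a b; pose d := msupp a `|` msupp b `|` msupp (a - b).
have ha : msupp a `<=` d by rewrite /d -fsetUA fsubsetUl.
have hb : msupp b `<=` d.
  by rewrite /d (fsetUC (msupp a)) -fsetUA fsubsetUl.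
have hab : msupp (a - b) `<=` d by rewrite /d fsubsetUr.
rewrite (lin_extw ha) (lin_extw hb) (lin_extw hab) -sumrB.
by apply: eq_bigr => i _; rewrite mcoeffB FB.
Qed.

Lemma lin_extU t j : lin_ext (monom t j) = F j t.
Proof.
by rewrite (lin_extw (d := [fset j])) ?msuppU_le // big_seq_fset1 mcoeffUU.
Qed.

End LinearExtension.

Lemma skew_ind (P : skewLaurent K -> Prop) :
  P 0 -> (forall a b, P a -> P b -> P (a + b)) ->
  (forall t j, P (monom t j)) -> forall a, P a.
Proof.
move=> P0 PD PU a; rewrite [a]monalgE.
by elim/big_ind: _ => // i _; apply: PU.
Qed.

(* (t S^i) (u S^j) = t(x) u(x + i) S^(i + j) *)
Definition skew_mul a b : skewLaurent K :=
  \sum_(i <- msupp a) \sum_(j <- msupp b) monom (a@_i * shift i b@_j) (i + j).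

Let mulF i t j u : skewLaurent K := monom (t * shift i u) (i + j).

Let mulFB i t j : zmod_morphism (mulF i t j).
Proof. by move=> u v; rewrite /mulF raddfB mulrBr monomB. Qed.

Let mulFB' b i : zmod_morphism (fun t => lin_ext (mulF i t) b).
Proof.
move=> t u; rewrite /lin_ext -sumrB.
by apply: eq_bigr => j _; rewrite /mulF mulrBl monomB.
Qed.

Lemma skew_mulBl b : zmod_morphism (skew_mul^~ b).
Proof. exact: (lin_ext_additive (mulFB' b)). Qed.

Lemma skew_mulBr a : zmod_morphism (skew_mul a).
Proof.
move=> b c; rewrite /skew_mul -sumrB; apply: eq_bigr => i _.
exact: (lin_ext_additive (@mulFB i a@_i)).
Qed.

Lemma skew_mulUU t i u j :
  skew_mul (monom t i) (monom u j) = monom (t * shift i u) (i + j).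
Proof.
transitivity (lin_ext (mulF i t) (monom u j)); last exact: lin_extU.
exact: (lin_extU (mulFB' (monom u j))).
Qed.

Lemma skew_mul0l : left_zero 0 skew_mul.
Proof. move=> a; exact: (zmod_morph0 (skew_mulBl a)). Qed.

Lemma skew_mul0r : right_zero 0 skew_mul.
Proof. move=> a; exact: (zmod_morph0 (skew_mulBr a)). Qed.

Lemma skew_mulDl : left_distributive skew_mul +%R.
Proof. move=> a b c; exact: (zmod_morphD (skew_mulBl c)). Qed.

Lemma skew_mulDr : right_distributive skew_mul +%R.
Proof. move=> a b c; exact: (zmod_morphD (skew_mulBr a)). Qed.

Lemma skew_mulA : associative skew_mul.
Proof.
move=> a b c; elim/skew_ind: a => [|a a' Ha Ha'|t i].
- by rewrite !skew_mul0l.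
- by rewrite !skew_mulDl Ha Ha'.
elim/skew_ind: b => [|b b' Hb Hb'|u j].
- by rewrite skew_mul0r !skew_mul0l skew_mul0r.
- by rewrite skew_mulDr !skew_mulDl skew_mulDr Hb Hb'.
elim/skew_ind: c => [|c c' Hc Hc'|v k].
- by rewrite !skew_mul0r.
- by rewrite !skew_mulDr Hc Hc'.
by rewrite !skew_mulUU rmorphM /= shiftD mulrA addrA.
Qed.

Lemma skew_mul1l : left_id (monom 1 0) skew_mul.
Proof.
move=> a; elim/skew_ind: a => [|a a' Ha Ha'|t i]; first by rewrite skew_mul0r.
  by rewrite skew_mulDr Ha Ha'.
by rewrite skew_mulUU shift0 mul1r add0r.
Qed.

Lemma skew_mul1r : right_id (monom 1 0) skew_mul.
Proof.
move=> a; elim/skew_ind: a => [|a a' Ha Ha'|t i].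
- by rewrite skew_mul0l.
- by rewrite skew_mulDl Ha Ha'.
by rewrite skew_mulUU rmorph1 mulr1 addr0.
Qed.

Lemma skew_one_neq0 : monom 1 0 != 0.
Proof. by rewrite /monom monalgU_eq0 oner_neq0. Qed.

HB.instance Definition _ := GRing.Zmodule_isNzRing.Build (skewLaurent K)
  skew_mulA skew_mul1l skew_mul1r skew_mulDl skew_mulDr skew_one_neq0.

Lemma monomM t i u j :
  monom t i * monom u j = monom (t * shift i u) (i + j).
Proof. exact: skew_mulUU. Qed.

Definition polyA t : skewLaurent K := monom t 0.
Definition cst (k : K) : skewLaurent K := polyA k%:P.
Definition Spow j : skewLaurent K := monom 1 j.
Definition Sop : skewLaurent K := Spow 1.
Definition Sinv : skewLaurent K := Spow (-1).
Definition xop : skewLaurent K := polyA 'X.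

Lemma S_x : Sop * xop = (xop + 1) * Sop.
Proof.
have -> : xop + 1 = polyA ('X + 1) by exact: esym (zmod_morphD (monomB 0) _ _).
rewrite /Sop /xop /polyA /Spow !monomM mul1r addr0 add0r rmorph1 mulr1.
by rewrite /shift comp_polyX.
Qed.

Lemma S_Sinv : Sop * Sinv = 1.
Proof. by rewrite monomM mul1r rmorph1. Qed.

Lemma Sinv_S : Sinv * Sop = 1.
Proof. by rewrite monomM mul1r rmorph1. Qed.

Lemma monomE t j : monom t j = polyA t * Spow j.
Proof. by rewrite monomM rmorph1 mulr1 add0r. Qed.

(* The action on K[x]: the sum of the t_j S^j maps f(x) to that of the
   t_j(x) f(x + j). *)
Definition act a f : {poly K} := \sum_(j <- msupp a) a@_j * shift j f.

Let actFB f j : zmod_morphism (fun t => t * shift j f).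
Proof. by move=> t u; rewrite mulrBl. Qed.

Lemma actBl f : zmod_morphism (act^~ f).
Proof. exact: (lin_ext_additive (actFB f)). Qed.

Lemma actBr a : zmod_morphism (act a).
Proof.
move=> f g; rewrite /act -sumrB.
by apply: eq_bigr => j _; rewrite raddfB mulrBr.
Qed.
HB.instance Definition _ a :=
  GRing.isZmodMorphism.Build {poly K} {poly K} (act a) (actBr a).

Lemma act_monom t j f : act (monom t j) f = t * shift j f.
Proof. exact: (lin_extU (actFB f)). Qed.

Lemma act1 f : act 1 f = f.
Proof. by rewrite act_monom shift0 mul1r. Qed.

Lemma actM a b f : act (a * b) f = act a (act b f).
Proof.
elim/skew_ind: a => [|a a' Ha Ha'|t i].
- by rewrite mul0r !(zmod_morph0 (actBl _)).
- by rewrite mulrDl !(zmod_morphD (actBl _)) /= Ha Ha'.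
elim/skew_ind: b => [|b b' Hb Hb'|u j].
- by rewrite mulr0 (zmod_morph0 (actBl _)) raddf0.
- by rewrite mulrDr !(zmod_morphD (actBl _)) raddfD /= Hb Hb'.
by rewrite monomM !act_monom rmorphM /= shiftD mulrA.
Qed.

(* a lies in K[S, S^-1]: all its coefficients are constants. *)
Definition is_laurent a : Prop := forall j, (size a@_j <= 1)%N.

Definition laurent (p q : int) (c : int -> K) : skewLaurent K :=
  \sum_(j <- int_range p q) cst (c j) * Spow j.

Lemma laurentP p q (c : int -> K) : is_laurent (laurent p q c).
Proof.
have z k : (size ((0 : skewLaurent K)@_k) <= 1)%N by rewrite mcoeff0 size_poly0.
rewrite /laurent => k; elim/big_ind: _ k => [|a b Ha Hb|j _] k //.
- rewrite mcoeffD (leq_trans (size_polyD _ _)) //.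
  by rewrite geq_max Ha Hb.
rewrite -monomE mcoeffU; case: eqP => _; last by rewrite size_poly0.
exact: size_polyC_leq1.
Qed.

(* Value at S = 1 of an element of K[S, S^-1]. *)
Definition at_one a : K := \sum_(j <- msupp a) (a@_j)`_0.

Definition Dop : skewLaurent K := Sop - 1.
Definition Xop : skewLaurent K := xop * Sinv.

Definition commutator a b : skewLaurent K := a * b - b * a.

Definition sl2_triple (E H F : skewLaurent K) : Prop :=
  [/\ commutator H E = 2 * E,
      commutator H F = - (2 * F) &
      commutator E F = H].

Definition H_op (g : skewLaurent K) (lambda : K) : skewLaurent K :=
  2 * (Xop + g) * Dop - cst lambda.

Definition E_op (g : skewLaurent K) (lambda : K) : skewLaurent K :=
  (Xop + g) ^+ 2 * Dop - cst lambda * (Xop + g).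

Definition monic_eigenpoly (H : skewLaurent K) (lambda : K) (n : nat)
    (f : {poly K}) : Prop :=
  [/\ f \is monic, size f = n.+1 & act H f = (2 * n%:R - lambda) *: f].

Definition sl2_parameters (E H g : skewLaurent K) (lambda : K) : Prop :=
  [/\ is_laurent g, H = H_op g lambda & E = E_op g lambda].

(* f is the member of degree n of the monic eigenbasis associated with the
   triple (E, H, 1 - S). *)
Definition associated_eigenpoly (E H : skewLaurent K) (n : nat)
    (f : {poly K}) : Prop :=
  exists (g : skewLaurent K) (lambda : K),
    sl2_parameters E H g lambda /\ monic_eigenpoly H lambda n f.

Definition spectral_equation (p q : int) (c : int -> K) (n : nat)
    (f : {poly K}) : Prop :=
  'X * (f - shift (-1) f)
    + \sum_(j <- int_range p q) c j *: (shift (j + 1) f - shift j f)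
  = n%:R *: f.

Definition remainder (H : skewLaurent K) : skewLaurent K :=
  H - (2 * xop - 2 * xop * Sinv).

(* g = (R(S) - R(1)) / (2 (S - 1)) in K[S, S^-1], which is a domain in which
   2 (S - 1) is nonzero when K has characteristic zero. *)
Definition recovered_from (H g : skewLaurent K) : Prop :=
  is_laurent g /\
  2 * (Sop - 1) * g = remainder H - cst (at_one (remainder H)).

End SkewLaurent.

Arguments Sop {K}.
Arguments Sinv {K}.
Arguments xop {K}.
Arguments Dop {K}.
Arguments Xop {K}.

(* Main.v *)
Require Import Defs.
From HB Require Import structures.
From mathcomp Require Import all_boot all_order all_algebra.
From mathcomp Require Import zify.
From mathcomp Require Import finmap.
From mathcomp.multinomials Require Import monalg.

Set Implicit Arguments.
Unset Strict Implicit.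
Unset Printing Implicit Defensive.

Import Order.TTheory GRing.Theory Num.Theory.
Local Open Scope ring_scope.

(* Put Y = X + g, so that [D, Y] = 1 and H = 2 Y D - lambda; the eigenvalue
   equation of H is then Y D f = n f, which does not involve lambda and which,
   written out, is the spectral equation.  Its monic solution is p_n = Y^n 1; it
   is unique because D lowers both the degree and the eigenvalue by one.
   Conversely, [H, 1 - S] = - 2 (1 - S) makes H - 2 X D commute with S, and the
   elements commuting with S are the Laurent polynomials, so g is obtained by
   dividing by S - 1.  Then E differs from Y^2 D - lambda Y by a Laurent
   polynomial h with [H, h] = 2 h, whose coefficients satisfy
   (k + 1) h_(k + 1) = (k + 1) h_k for all k; being finitely supported,
   h = 0. *)

(** * Commutator identities in a ring *)

Section Bracket.
Variable R : nzRingType.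
Implicit Types a b c : R.

(** Taken over an arbitrary ring so that the operators are opaque in the computations; on
    [skewLaurent K] it is convertible with [commutator]. *)
Definition bracket a b := a * b - b * a.

Lemma bracket_eq0 a b : bracket a b = 0 <-> GRing.comm a b.
Proof.
split=> [/eqP|ab]; first by rewrite subr_eq0 => /eqP.
by rewrite /bracket ab subrr.
Qed.

Lemma bracketC a b : bracket b a = - bracket a b.
Proof. by rewrite opprB. Qed.

Lemma bracketBl a b c :
  bracket (a - b) c = bracket a c - bracket b c.
Proof. by rewrite /bracket mulrBl mulrBr opprD addrACA -opprD. Qed.

Lemma bracketBr a b c :
  bracket a (b - c) = bracket a b - bracket a c.
Proof. by rewrite /bracket mulrBl mulrBr opprD addrACA -opprD. Qed.

Lemma bracketNr a b : bracket a (- b) = - bracket a b.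
Proof. by rewrite /bracket mulrN mulNr opprB opprK addrC. Qed.

Lemma bracketMl a b c :
  bracket (a * b) c = a * bracket b c + bracket a c * b.
Proof. by rewrite /bracket mulrBr mulrBl !mulrA addrA subrK. Qed.

Lemma bracketMr a b c :
  bracket a (b * c) = bracket a b * c + b * bracket a c.
Proof. by rewrite /bracket mulrBr mulrBl !mulrA addrA subrK. Qed.

Lemma bracket_natl n a b :
  bracket (n%:R * a) b = n%:R * bracket a b.
Proof.
rewrite bracketMl (bracket_eq0 n%:R b).2 ?mul0r ?addr0 //.
exact/commr_sym/commr_nat.
Qed.

Lemma bracket_eq1 a b : bracket a b = 1 -> a * b = b * a + 1.
Proof. by move=> <-; rewrite addrC subrK. Qed.

(** Of the Leibniz expansion only the bracket with [x] survives. Used with [x] = X, [d] = D, [y] and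
    [h] in K[S, S^-1] and [l] = lambda. *)
Lemma bracket_H x y d l h :
    GRing.comm y h -> GRing.comm d h -> GRing.comm l h ->
  bracket (2 * (x + y) * d - l) h = 2 * (bracket x h * d).
Proof.
move=> yh dh lh; rewrite bracketBl (bracket_eq0 l h).2 // subr0.
rewrite -mulrA bracket_natl bracketMl (bracket_eq0 d h).2 // mulr0 add0r.
rewrite -[y]opprK bracketBl (bracket_eq0 (- y) h).2 ?subr0 //.
exact/commr_sym/commrN/commr_sym.
Qed.

(** * The sl_2 relations derived from [d, y] = 1 *)

Section WeylPair.
Variables d y l : R.
Hypotheses (dy : bracket d y = 1) (ly : GRing.comm l y).
Hypothesis ld : GRing.comm l d.

Lemma weyl_bracket_HF : bracket (2 * y * d - l) (- d) = - (2 * - d).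
Proof.
rewrite bracketNr bracketBl (bracket_eq0 l d).2 // subr0 -mulrA.
rewrite bracket_natl bracketMl (bracket_eq0 d d).2 // mulr0 add0r.
by rewrite bracketC dy mulN1r.
Qed.

Lemma weyl_bracket_EF :
  bracket (y ^+ 2 * d - l * y) (- d) = 2 * y * d - l.
Proof.
have yd : bracket y d = -1 by rewrite bracketC dy.
rewrite bracketNr bracketBl bracketMl (bracket_eq0 d d).2 //.
rewrite bracketMl (bracket_eq0 l d).2 // bracketMl yd.
rewrite mulr0 mul0r add0r addr0 mulrN1 mulN1r -opprD mulNr mulrN1 opprB opprK.
by rewrite addrC -mulr2n -[y *+ 2]mulr_natl.
Qed.

Lemma weyl_bracket_HE :
  bracket (2 * y * d - l) (y ^+ 2 * d - l * y) = 2 * (y ^+ 2 * d - l * y).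
Proof.
have lyd : GRing.comm l (y * d) by apply: commrM.
(* In this factorization y d commutes with the second factor, so only [y d, y] = y contributes. *)
have -> : y ^+ 2 * d - l * y = y * (y * d - l) by rewrite mulrBr mulrA -ly.
rewrite bracketBl -mulrA bracket_natl (bracket_eq0 l _).2; last first.
  by apply: commrM => //; apply: commrB.
rewrite subr0 bracketMr (bracket_eq0 _ (y * d - l)).2; last first.
  by apply: commrB => //; apply: commr_sym.
rewrite mulr0 addr0 bracketMl dy (bracket_eq0 y y).2 //.
by rewrite mulr1 mul0r addr0.
Qed.

End WeylPair.
End Bracket.

(** * Coefficients of products, commutation and the action on K[x] *)

Section SkewLaurentTheory.
Variable K : fieldType.
Implicit Types (t u f : {poly K}) (a b g h H : skewLaurent K) (i j k : int).
Implicit Type lambda : K.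

Lemma mcoeff_monomMl t i a k : (monom t i * a)@_k = t * shift i a@_(k - i).
Proof.
elim/skew_ind: a => [|a b Ha Hb|u j].
- by rewrite mulr0 !mcoeff0 raddf0 mulr0.
- by rewrite mulrDr !mcoeffD raddfD mulrDr Ha Hb.
rewrite monomM !mcoeffU [i + j]addrC -(can2_eq (addrK i) (subrK i)).
by rewrite raddfMn mulrnAr.
Qed.

Lemma mcoeff_monomMr t i a k :
  (a * monom t i)@_k = a@_(k - i) * shift (k - i) t.
Proof.
elim/skew_ind: a => [|a b Ha Hb|u j].
- by rewrite mul0r !mcoeff0 mul0r.
- by rewrite mulrDl !mcoeffD mulrDl Ha Hb.
rewrite monomM !mcoeffU -(can2_eq (addrK i) (subrK i)).
by have [<-|_] := eqVneq (j + i) k; rewrite ?addrK // mul0r.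
Qed.

Lemma shiftC i (x : K) : shift i x%:P = x%:P.
Proof. exact: comp_polyC. Qed.

Lemma shiftX i : shift i 'X = 'X + (i%:~R)%:P :> {poly K}.
Proof. exact: comp_polyX. Qed.

Lemma cst_comm (x : K) a : GRing.comm (cst x) a.
Proof.
apply/malgP => k; rewrite mcoeff_monomMl mcoeff_monomMr.
by rewrite !subr0 shift0 shiftC mulrC.
Qed.

Lemma cstM (x y : K) : cst x * cst y = cst (x * y).
Proof. by rewrite monomM shift0 addr0 -polyCM. Qed.

Lemma cst_zmod_morphism : zmod_morphism (@cst K).
Proof. by move=> x y; rewrite /cst polyCB; exact: monomB. Qed.
HB.instance Definition _ :=
  GRing.isZmodMorphism.Build K (skewLaurent K) (@cst K) cst_zmod_morphism.

Lemma cst_nat n : cst n%:R = n%:R :> skewLaurent K.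
Proof. by rewrite raddfMn. Qed.

Lemma Spow_nat n : Spow K n%:Z = Sop ^+ n.
Proof.
elim: n => // n IHn; rewrite exprS -IHn monomM rmorph1 mulr1.
by rewrite -intS.
Qed.

Lemma Spow_opp_nat n : Spow K (- n%:Z) = Sinv ^+ n.
Proof.
elim: n => [|n IHn]; first by rewrite oppr0.
by rewrite exprS -IHn monomM rmorph1 mulr1 -opprD -intS.
Qed.

Lemma comm_Sinv a : GRing.comm a Sop -> GRing.comm a Sinv.
Proof.
move=> aS; rewrite /GRing.comm -[a in LHS]mul1r -Sinv_S -!mulrA [Sop * _]mulrA.
by rewrite -aS -mulrA S_Sinv mulr1.
Qed.

Lemma comm_Spow a j : GRing.comm a Sop -> GRing.comm a (Spow K j).
Proof.
move=> aS; case: (intP j) => [|n|n]; first exact: commr1.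
  by rewrite Spow_nat; apply: commrX.
by rewrite Spow_opp_nat; apply/commrX/comm_Sinv.
Qed.

Lemma act0l f : act 0 f = 0.
Proof. exact: (zmod_morph0 (actBl f)). Qed.

Lemma actDl a b f : act (a + b) f = act a f + act b f.
Proof. exact: (zmod_morphD (actBl f)). Qed.

Lemma act_nat n f : act n%:R f = n%:R *: f.
Proof. by rewrite -cst_nat act_monom shift0 mul_polyC. Qed.

Lemma act_cst (x : K) f : act (cst x) f = x *: f.
Proof. by rewrite act_monom shift0 mul_polyC. Qed.

Lemma actZr a (x : K) f : act a (x *: f) = x *: act a f.
Proof. by rewrite -!act_cst -!actM cst_comm. Qed.

Lemma act_Dop f : act Dop f = shift 1 f - f.
Proof. by rewrite actBl act1 act_monom mul1r. Qed.

Lemma act_Dop1 : act Dop 1 = 0 :> {poly K}.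
Proof. by rewrite act_Dop rmorph1 subrr. Qed.

Lemma act_Xop f : act Xop f = 'X * shift (-1) f.
Proof. by rewrite actM !act_monom shift0 mul1r. Qed.

Lemma act_laurent p q (c : int -> K) f :
  act (laurent p q c) f = \sum_(j <- int_range p q) c j *: shift j f.
Proof.
rewrite /laurent; elim/big_ind2: _ => [|a u b v <- <-|j _] //.
- exact: act0l.
- exact: actDl.
by rewrite actM act_cst act_monom mul1r.
Qed.

(** Every power of S fixes the constant 1, so evaluation at S = 1 is the action on 1; its linearity
    is inherited from [act]. *)
Lemma at_oneE a : at_one a = (act a 1)`_0.
Proof.
rewrite /at_one /act coef_sum.
by apply: eq_bigr => j _; rewrite rmorph1 mulr1.
Qed.

(** * Laurent polynomials and commutation with S *)

Lemma mcoeff_laurent p q (c : int -> K) k :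
  (laurent p q c)@_k = if p <= k <= q then (c k)%:P else 0.
Proof.
rewrite raddf_sum /= -mem_int_range.
under eq_bigr => j _ do rewrite -monomE mcoeffU.
case: ifP => [kr|kr].
  rewrite (bigD1_seq k) ?int_range_uniq //= eqxx big1 ?addr0 // => j.
  by rewrite eq_sym [k == j]eq_sym => /negbTE ->.
by rewrite big_seq big1 // => j jr; case: eqP jr => // ->; rewrite kr.
Qed.

Lemma mcoeff_eventually0 a : exists N : nat, forall k, (N < `|k|)%N -> a@_k = 0.
Proof.
exists (\max_(i <- msupp a) `|i|)%N => k.
have [ka|/mcoeff_outdom //] := boolP (k \in msupp a).
by rewrite ltnNge (leq_bigmax_seq k).
Qed.

Lemma is_laurentE a :
  is_laurent a -> exists p q (c : int -> K), a = laurent p q c.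
Proof.
move=> La; have [N aN] := mcoeff_eventually0 a.
exists (- N%:Z), N%:Z, (fun k => (a@_k)`_0); apply/malgP => k.
rewrite mcoeff_laurent -ler_norml -size1_polyC //.
by case: ifPn => //; rewrite -abszE lez_nat -ltnNge => /aN.
Qed.

Lemma is_laurent_comm a : is_laurent a -> GRing.comm a Sop.
Proof.
move=> La; apply/malgP => k; rewrite mcoeff_monomMl mcoeff_monomMr.
by rewrite rmorph1 mulr1 mul1r (size1_polyC (La _)) shiftC.
Qed.

Lemma comm_laurent a g : GRing.comm a Sop -> is_laurent g -> GRing.comm a g.
Proof.
move=> aS /is_laurentE[p [q [c ->]]]; apply: commr_sum => j _.
by apply: commrM; [apply/commr_sym/cst_comm | apply: comm_Spow].
Qed.

(** * Degrees under shift and difference; eventually constant coefficients *)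

Lemma size_shift j f : size (shift j f) = size f.
Proof. by rewrite size_comp_poly2 // size_XaddC. Qed.

Lemma lead_coef_shift j f : lead_coef (shift j f) = lead_coef f.
Proof.
by rewrite lead_coef_comp ?size_XaddC // lead_coefXaddC expr1n mulr1.
Qed.

Lemma size_delta n f : (size f <= n.+1)%N -> (size (shift 1 f - f)%R <= n)%N.
Proof.
move=> fn; apply/leq_sizeP => k nk; rewrite coefB.
have [sk|] := leqP (size f) k.
  by rewrite !nth_default ?size_shift // subrr.
(* The bounds leave only the top index, where the leading coefficients of f(x + 1) and f cancel. *)
move=> kf; have kE : k = (size f).-1.
  by apply/eqP; rewrite eqn_leq -ltnS (ltn_predK kf) kf -ltnS
                        (ltn_predK kf) (leq_trans fn).
rewrite [in f`_k]kE kE -[in X in X - _](size_shift 1) -!lead_coefE.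
by rewrite lead_coef_shift subrr.
Qed.

(** The value at [k] propagates beyond the finite support, where it is 0. *)
Lemma mcoeff_const_up a k :
  (forall j, k <= j -> a@_(j + 1) = a@_j) -> a@_k = 0.
Proof.
move=> aj; have [N aN] := mcoeff_eventually0 a.
have ak n : a@_(k + n%:Z) = a@_k.
  elim: n => [|n <-]; first by rewrite addr0.
  by rewrite -addn1 PoszD addrA aj // lerDl.
(* A shift by N + |k| + 1 leaves [-N, N] whatever the sign of [k]. *)
rewrite -(ak (N + `|k|).+1%N) aN //; lia.
Qed.

Lemma mcoeff_const_down a k :
  (forall j, j < k -> a@_(j + 1) = a@_j) -> a@_k = 0.
Proof.
move=> aj; have [N aN] := mcoeff_eventually0 a.
have ak n : a@_(k - n%:Z) = a@_k.
  elim: n => [|n <-]; first by rewrite subr0.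
  by rewrite -aj; [congr (a@_ _); lia | lia].
rewrite -(ak (N + `|k|).+1%N) aN //; lia.
Qed.

(** The coefficients of D g are the differences of consecutive coefficients of [g], which is thus
    constant along the integers. This makes division by S - 1 unique. *)
Lemma Dop_laurent_inj g : is_laurent g -> Dop * g = 0 -> g = 0.
Proof.
move=> Lg Dg; apply/malgP => k; rewrite mcoeff0.
apply: mcoeff_const_down => j _.
move/(congr1 (fun b : {malg {poly K}[int]} => b@_(j + 1))): Dg.
rewrite /Dop mulrBl mul1r mcoeffB mcoeff_monomMl mul1r addrK mcoeff0.
by rewrite (size1_polyC (Lg j)) shiftC => /eqP; rewrite subr_eq0 => /eqP.
Qed.

(** * The pair D, X + g, the shape of H, and division by S - 1 *)

Lemma Xop_Sop : Xop * Sop = xop :> skewLaurent K.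
Proof. by rewrite /Xop -mulrA Sinv_S mulr1. Qed.

Lemma Sop_Xop : Sop * Xop = xop + 1 :> skewLaurent K.
Proof. by rewrite /Xop mulrA S_x -mulrA S_Sinv mulr1. Qed.

Lemma comm_Dop a : GRing.comm a Sop -> GRing.comm a Dop.
Proof. by move=> aS; apply: commrB => //; apply: commr1. Qed.

Lemma bracket_Dop_Xop : bracket Dop Xop = 1 :> skewLaurent K.
Proof.
rewrite /bracket mulrBl mulrBr mul1r mulr1 Sop_Xop Xop_Sop opprB subrKA.
by rewrite addrAC subrr add0r.
Qed.

Lemma bracket_Dop g : is_laurent g -> bracket Dop (Xop + g) = 1.
Proof.
move=> Lg; rewrite -[g]opprK bracketBr bracket_Dop_Xop bracketNr.
rewrite (bracket_eq0 _ g).2 ?opprK ?addr0 //.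
exact/commr_sym/comm_Dop/is_laurent_comm.
Qed.

Lemma sl2_triple_op g lambda :
  is_laurent g -> sl2_triple (E_op g lambda) (H_op g lambda) (- Dop).
Proof.
move=> Lg; have dy := bracket_Dop Lg.
have ly := cst_comm lambda (Xop + g); have ld := cst_comm lambda Dop.
split; [exact: weyl_bracket_HE | exact: weyl_bracket_HF |].
exact: weyl_bracket_EF.
Qed.

(** Since X S = x, the term 2x - 2x S^-1 is 2 X D, the H of the parameters g = 0, lambda = 0. *)
Lemma remainderE H : remainder H = H - 2 * Xop * Dop.
Proof.
rewrite /remainder -[2 * Xop * _]mulrA /Dop mulrBr Xop_Sop mulr1 mulrBr.
by rewrite [in RHS]/Xop mulrA.
Qed.

(** Clearing the denominator gives R = 2 g D + R(1), hence H = 2 (X + g) D + R(1); this is where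
    lambda = -R(1) comes from. *)
Lemma recovered_H_op H g :
  recovered_from H g -> H = H_op g (- at_one (remainder H)).
Proof.
case=> Lg; rewrite -/Dop -mulrA => gE.
have gD : Dop * g = g * Dop by apply/esym/comm_Dop/is_laurent_comm.
have collect (R : nzRingType) (x y d l r e : R) :
    2 * (y * d) = r - l -> e - 2 * x * d = r -> e = 2 * (x + y) * d + l.
  move=> yd /eqP; rewrite subr_eq => /eqP ->.
  by rewrite -!mulrA [(x + y) * d]mulrDl mulrDr yd -addrA subrK addrC.
rewrite /H_op raddfN opprK; apply: (collect _ _ _ _ _ (remainder H)).
  by rewrite -gD gE.
by rewrite remainderE.
Qed.

Lemma act_H_op g lambda f :
  act (H_op g lambda) f = 2 *: act ((Xop + g) * Dop) f - lambda *: f.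
Proof. by rewrite /H_op actBl act_cst -mulrA actM act_nat. Qed.

(** D kills the constant 1, so H maps 1 to -lambda whatever the Laurent part. *)
Lemma H_op_lambda_inj g h lambda mu : H_op g lambda = H_op h mu -> lambda = mu.
Proof.
have H1 a x : act (H_op a x) 1 = - x%:P.
  by rewrite act_H_op actM act_Dop1 !raddf0 sub0r alg_polyC.
move=> e; apply/polyC_inj/oppr_inj.
by rewrite -(H1 g) -(H1 h) e.
Qed.

(** Division by a geometric sum. The quotient is recorded as commuting with S, which in
    characteristic zero places it in K[S, S^-1]. *)
Lemma Spow_sub1 j : exists2 h, GRing.comm h Sop & Spow K j - 1 = Dop * h.
Proof.
case: (intP j) => [|n|n].
- by exists 0; [exact/commr_sym/commr0 | rewrite mulr0 subrr].
- exists (\sum_(i < n.+1) Sop ^+ i); last by rewrite Spow_nat subrX1.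
  by apply/commr_sym/commr_sum => i _; apply/commrX/commr_refl.
have SSinv : GRing.comm (@Sop K) Sinv by apply/comm_Sinv/commr_refl.
(* The factor -S^-1 comes from S^-1 - 1 = (S - 1)(-S^-1). *)
exists (- Sinv * \sum_(i < n.+1) Sinv ^+ i).
  apply: commr_sym; apply: commrM; first exact: commrN.
  by apply: commr_sum => i _; apply: commrX.
rewrite Spow_opp_nat subrX1 mulrA; congr (_ * _).
by rewrite mulrBl mulrN S_Sinv mul1r opprK addrC.
Qed.

Lemma size_act_laurent g f : is_laurent g -> (size (act g f) <= size f)%N.
Proof.
case/is_laurentE => p [q [c ->]]; rewrite act_laurent.
apply: (leq_trans (size_sum _ _ _)); apply/bigmax_leqP_seq => j _ _.
by rewrite (leq_trans (size_scale_leq _ _)) // size_shift.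
Qed.

(** X f = x f(x - 1) supplies the new leading term, while [g] does not raise the degree. *)
Lemma act_raise_monic g f : is_laurent g -> f \is monic ->
  act (Xop + g) f \is monic /\ size (act (Xop + g) f) = (size f).+1.
Proof.
move=> Lg fm; rewrite actDl act_Xop.
have sm : shift (-1) f \is monic by rewrite monicE lead_coef_shift -monicE.
have sX : size ('X * shift (-1) f) = (size f).+1.
  by rewrite mulrC size_mulX ?monic_neq0 // size_shift.
have lt : (size (act g f) < size ('X * shift (-1) f)%R)%N.
  by rewrite sX ltnS size_act_laurent.
rewrite size_polyDl // sX; split => //.
by rewrite monicE lead_coefDl // -monicE monicMl ?monicX.
Qed.

End SkewLaurentTheory.

(** * Characteristic zero: recovering g and excluding other E *)

Section CharacteristicZero.
Variable K : fieldType.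
Hypothesis charK0 : [pchar K] =i pred0.
Implicit Types (f t : {poly K}) (a b g h E H : skewLaurent K) (lambda : K).

Let natr_eq0 n : (n%:R == 0 :> K) = (n == 0%N).
Proof. by move/pcharf0P: charK0. Qed.

Let two_neq0 : 2 != 0 :> K.
Proof. by rewrite natr_eq0. Qed.

Lemma cst_half_two : cst 2^-1 * 2 = 1 :> skewLaurent K.
Proof. by rewrite -cst_nat cstM mulVf. Qed.

Lemma two_mulI : injective (fun a => 2 * a).
Proof.
by move=> a b /(congr1 ( *%R (cst 2^-1))); rewrite !mulrA cst_half_two !mul1r.
Qed.

(* A shift-invariant polynomial takes the value f(0) at every natural number. *)
Lemma shift_fixed f : shift 1 f = f -> (size f <= 1)%N.
Proof.
move=> ff; have fn n : f.[n%:R] = f.[0].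
  elim: n => // n <-; rewrite -[in RHS]ff horner_comp !hornerE.
  by rewrite natr1.
suff: f - f.[0]%:P == 0 by rewrite subr_eq0 => /eqP ->; exact: size_polyC_leq1.
apply: contraT => nz.
have := @max_poly_roots _ _ [seq n%:R | n <- iota 0 (size (f - f.[0]%:P)%R)] nz.
rewrite size_map size_iota ltnn => -> //.
  by apply/allP => _ /mapP[n _ ->]; rewrite /root !hornerE fn subrr.
rewrite map_inj_uniq ?iota_uniq // => m n /eqP.
wlog le : m n / (m <= n)%N.
  case/orP: (leq_total m n) => le W; first exact: W.
  by rewrite eq_sym => /W ->.
rewrite eq_sym -subr_eq0 -natrB // natr_eq0 subn_eq0 => nm.
by apply/eqP; rewrite eqn_leq le.
Qed.

(** Comparing the coefficients of S^(j + 1) in a S = S a gives t_j(x) = t_j(x + 1), so t_j is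
    constant. *)
Lemma comm_is_laurent a : GRing.comm a Sop -> is_laurent a.
Proof.
move=> aS j; apply: shift_fixed.
have /(congr1 (fun b : {malg {poly K}[int]} => b@_(j + 1))) := aS.
by rewrite mcoeff_monomMl mcoeff_monomMr rmorph1 mulr1 mul1r addrK.
Qed.

Lemma bracket_Dop_is_laurent a : bracket a (- Dop) = 0 -> is_laurent a.
Proof.
rewrite bracketNr => /eqP; rewrite oppr_eq0 => /eqP/bracket_eq0 aD.
apply: comm_is_laurent; rewrite -[Sop](subrK 1).
by apply: commrD => //; apply: commr1.
Qed.

(** H and 2 X D have the same bracket with F = -D, so their difference commutes with S. *)
Lemma triple_remainder_laurent E H :
  sl2_triple E H (- Dop) -> is_laurent (remainder H).
Proof.
case=> _ HF _; apply: bracket_Dop_is_laurent.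
(* Subtracting 0 exhibits 2 X D in the Weyl pair form with [l] = 0. *)
rewrite remainderE bracketBl -[2 * _ * _]subr0.
rewrite (weyl_bracket_HF (bracket_Dop_Xop K) (commr_sym (commr0 _))).
by rewrite [bracket H _]HF subrr.
Qed.

(** By linearity it suffices to divide c_j S^j - c_j, that is, S^j - 1. *)
Lemma laurent_sub_at_one a :
  is_laurent a -> exists2 h, is_laurent h & Dop * h = a - cst (at_one a).
Proof.
case/is_laurentE => p [q [c ->]]; rewrite /laurent.
suff [h hS ->] : exists2 h, GRing.comm h Sop &
    \sum_(j <- int_range p q) cst (c j) * Spow K j
      - cst (at_one (\sum_(j <- int_range p q) cst (c j) * Spow K j)) = Dop * h.
  by exists h => //; apply: comm_is_laurent.
elim/big_ind: _ => [|a' b' [h hS ha] [k kS kb]|j _].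
- exists 0; first exact/commr_sym/commr0.
  by rewrite at_oneE act0l coef0 mulr0 raddf0 subrr.
- exists (h + k); first by apply/commr_sym/commrD; apply/commr_sym.
  by rewrite mulrDr -ha -kb !at_oneE actDl coefD raddfD opprD addrACA.
have [h hS Sh] := Spow_sub1 K j.
exists (cst (c j) * h).
  by apply/commr_sym/commrM/commr_sym/hS; exact/commr_sym/cst_comm.
rewrite mulrA -(cst_comm _ Dop) -mulrA -Sh mulrBr mulr1; congr (_ - cst _).
by rewrite at_oneE actM act_cst act_monom rmorph1 mulr1 coefZ coef1 mulr1.
Qed.

Lemma recovered_exists H :
  is_laurent (remainder H) -> exists g, recovered_from H g.
Proof.
move=> /laurent_sub_at_one[h Lh Dh]; exists (cst 2^-1 * h); split.
  apply/comm_is_laurent/commr_sym/commrM; first exact/commr_sym/cst_comm.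
  exact/commr_sym/is_laurent_comm.
rewrite -Dh -/Dop mulrA -(cst_comm _ (2 * Dop)) !mulrA.
by rewrite cst_half_two mul1r.
Qed.

Lemma recovered_inj H g h : recovered_from H g -> recovered_from H h -> g = h.
Proof.
case=> Lg gE [Lh]; rewrite -gE -!mulrA => /two_mulI => DE.
apply/eqP; rewrite -subr_eq0; apply/eqP/Dop_laurent_inj.
  by apply/comm_is_laurent/commr_sym/commrB; apply/commr_sym/is_laurent_comm.
by rewrite mulrBr DE subrr.
Qed.

(** From S^m x = (x + m) S^m one gets [X, S^m] = -m S^(m - 1): bracketing with X is -d/dS. *)
Lemma mcoeff_bracket_Xop g k : is_laurent g ->
  (bracket Xop g)@_k = - ((k + 1)%:~R *: g@_(k + 1)).
Proof.
move=> Lg; rewrite /bracket /Xop.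
have -> : xop * Sinv = monom 'X (-1) :> skewLaurent K by rewrite -monomE.
rewrite mcoeffB mcoeff_monomMl mcoeff_monomMr opprK shiftX.
rewrite (size1_polyC (Lg _)) shiftC mulrDr mulrC opprD addrA subrr sub0r.
by rewrite -polyCM -mul_polyC -polyCM mulrC.
Qed.

(** The equation reads (1 - S) dh/dS = h, formally solved by multiples of 1/(1 - S), whose
    expansions in S or S^-1 are infinite. *)
Lemma raising_unique g lambda h : is_laurent g -> is_laurent h ->
  bracket (H_op g lambda) h = 2 * h -> h = 0.
Proof.
move=> Lg Lh; have hS := is_laurent_comm Lh.
rewrite bracket_H; last exact: cst_comm; last 2 first.
- exact/commr_sym/comm_laurent.
- exact/commr_sym/comm_Dop.
move/two_mulI => hE.
have rec k : (k + 1)%:~R *: h@_(k + 1) = (k + 1)%:~R *: h@_k.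
  move/(congr1 (fun b : {malg {poly K}[int]} => b@_k)): hE.
  rewrite /Dop mulrBr mulr1 mcoeffB mcoeff_monomMr rmorph1 mulr1.
  rewrite !mcoeff_bracket_Xop // subrK opprK addrC => /eqP.
  by rewrite subr_eq => /eqP ->; rewrite rmorphD /= scalerDl scale1r addrC.
have step k : k + 1 != 0 -> h@_(k + 1) = h@_k.
  move=> k1; apply: (scalerI _ (rec k)).
  by case: (intP (k + 1)) k1 => // m _; rewrite ?rmorphN ?oppr_eq0 natr_eq0.
(* The recurrence does not link the indices -1 and 0, so the half-lines on either side are treated
   separately. *)
apply/malgP => k; rewrite mcoeff0; have [k0|k0] := leP 0 k.
  by apply: mcoeff_const_up => j kj; apply: step; lia.
by apply: mcoeff_const_down => j kj; apply: step; lia.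
Qed.

(** * Existence and uniqueness of monic eigenpolynomials; the spectral equation *)

Lemma monic_eigenE g lambda n f :
  monic_eigenpoly (H_op g lambda) lambda n f <->
  [/\ f \is monic, size f = n.+1 & act ((Xop + g) * Dop) f = n%:R *: f].
Proof.
split=> -[fm sf e]; split=> //.
  (* The term -lambda f cancels on both sides, and then so does the factor 2. *)
  move/eqP: e; rewrite act_H_op scalerBl (can_eq (subrK _)) -scalerA => /eqP.
  exact: scalerI.
by rewrite act_H_op e scalerBl scalerA.
Qed.

Lemma eigenpoly_eq0 g n f : is_laurent g -> (size f <= n)%N ->
  act ((Xop + g) * Dop) f = n%:R *: f -> f = 0.
Proof.
move=> Lg; elim: n f => [|n IHn] f sf e.
  by apply/eqP; rewrite -size_poly_leq0.
(* As D Y = Y D + 1, the polynomial D f has eigenvalue [n] under Y D, and its size is at most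
   [n]. *)
have Df0 : act Dop f = 0.
  apply: IHn; first by rewrite act_Dop size_delta.
  have := congr1 (act Dop) e.
  rewrite -actM mulrA (bracket_eq1 (bracket_Dop Lg)) mulrDl mul1r.
  rewrite actDl actM actZr -natr1 scalerDl scale1r.
  exact: addIr.
move/eqP: e; rewrite actM Df0 raddf0 eq_sym scaler_eq0 natr_eq0 /=.
by move/eqP.
Qed.

(** The difference of two solutions loses its leading term, so its degree is below [n] while its
    eigenvalue is still [n]. *)
Lemma eigenpoly_unique g lambda n f t : is_laurent g ->
    monic_eigenpoly (H_op g lambda) lambda n f ->
    monic_eigenpoly (H_op g lambda) lambda n t -> f = t.
Proof.
move=> Lg /monic_eigenE[fm sf fe] /monic_eigenE[tm st te].
apply/eqP; rewrite -subr_eq0; apply/eqP/(@eigenpoly_eq0 g n) => //; last first.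
  by rewrite raddfB scalerBr -fe -te.
apply/leq_sizeP => k; rewrite leq_eqVlt => /predU1P[<-|nk].
  move/monicP: fm; move/monicP: tm; rewrite !lead_coefE sf st /= coefB => -> ->.
  exact: subrr.
rewrite nth_default // (leq_trans (size_polyD _ _)) // size_polyN sf st.
by rewrite maxnn.
Qed.

(* Y = X + g raises the eigenvalue of Y D by one, because [D, Y] = 1. *)
Lemma eigenpoly_exists g lambda n : is_laurent g ->
  exists f, monic_eigenpoly (H_op g lambda) lambda n f.
Proof.
move=> Lg; exists (iter n (act (Xop + g)) 1); apply/monic_eigenE.
elim: n => [|n [fm sf fe]] /=.
  by rewrite monic1 size_poly1 actM act_Dop1 raddf0 scale0r.
have [gm gs] := act_raise_monic Lg fm; split=> //; first by rewrite gs sf.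
have := bracket_eq1 (bracket_Dop Lg); move: (iter n _ 1) fe => f.
move: (Xop + g) => y fe dy; rewrite -actM -mulrA dy mulrDr mulr1 actDl actM fe.
by rewrite actZr -natr1 scalerDl scale1r.
Qed.

(** This is Y D f = n f written out: X D f is x (f(x) - f(x - 1)) and S^j D f is f(x + j + 1) - f(x
    + j). *)
Lemma eigenpoly_spectral p q (c : int -> K) lambda n f :
  monic_eigenpoly (H_op (laurent p q c) lambda) lambda n f ->
  spectral_equation p q c n f.
Proof.
case/monic_eigenE => _ _; rewrite actM actDl act_Xop act_Dop act_laurent.
rewrite [shift (-1) _]raddfB /= shiftD addNr shift0 /spectral_equation => <-.
congr (_ + _).
by apply: eq_bigr => j _; rewrite [shift j (_ - _)]raddfB /= shiftD.
Qed.

(** Both E and [E_op g lambda] have bracket H with F, so their difference is a Laurent polynomial h;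
    it satisfies [H, h] = 2 h and vanishes. *)
Lemma triple_parameters E H g : sl2_triple E H (- Dop) -> recovered_from H g ->
  sl2_parameters E H g (- at_one (remainder H)).
Proof.
move=> EHF gH; have Lg := gH.1; have HE := recovered_H_op gH.
split=> //; move: (- at_one _) HE => lambda HE.
case: EHF => HE2 _ EF; have := sl2_triple_op lambda Lg; rewrite -HE.
move: (E_op g lambda) => E' [HE2' _ EF'].
apply/eqP; rewrite -subr_eq0; apply/eqP.
apply: (@raising_unique g lambda) => //.
  apply: bracket_Dop_is_laurent.
  by rewrite bracketBl [bracket E _]EF [bracket E' _]EF' subrr.
by rewrite -HE bracketBr [bracket _ E]HE2 [bracket _ E']HE2' -mulrBr.
Qed.

End CharacteristicZero.

Theorem corollary4p3 (K : fieldType) (charK0 : [pchar K] =i pred0) :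
  (forall (p q : int) (c : int -> K),
    let g := laurent p q c in
    (forall (lambda : K) (n : nat),
      (exists! f : {poly K}, monic_eigenpoly (H_op g lambda) lambda n f) /\
      (forall f : {poly K}, monic_eigenpoly (H_op g lambda) lambda n f ->
        spectral_equation p q c n f)) /\
    (forall (lambda mu : K) (n : nat) (f : {poly K}),
      monic_eigenpoly (H_op g lambda) lambda n f <->
      monic_eigenpoly (H_op g mu) mu n f)) /\
  (forall E H : skewLaurent K, sl2_triple E H (1 - Sop) ->
    is_laurent (remainder H) /\
    (exists! g : skewLaurent K, recovered_from H g) /\
    (forall g : skewLaurent K, recovered_from H g ->
      exists! lambda : K, sl2_parameters E H g lambda) /\
    (forall n : nat, exists! f : {poly K}, associated_eigenpoly E H n f) /\
    (exists (p q : int) (c : int -> K), recovered_from H (laurent p q c)) /\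
    (forall (p q : int) (c : int -> K), recovered_from H (laurent p q c) ->
      forall (n : nat) (f : {poly K}), associated_eigenpoly E H n f ->
        spectral_equation p q c n f)).
Proof.
split=> [p q c g|E H].
  have Lg : is_laurent g := laurentP p q c.
  split=> [lambda n|lambda mu n f].
    split=> [|f]; last exact: eigenpoly_spectral.
    have [f fE] := eigenpoly_exists charK0 lambda n Lg.
    by exists f; split=> // t; apply: eigenpoly_unique fE.
  by split=> /(monic_eigenE charK0)?; apply/(monic_eigenE charK0).
rewrite -opprB -/Dop => EHF; have LR := triple_remainder_laurent charK0 EHF.
have [g gH] := recovered_exists charK0 LR; have Lg := gH.1.
have par h := triple_parameters charK0 EHF (g := h).
(* The parameters in [associated_eigenpoly] are existential; the action of H on 1 forces lambda =
   -R(1). *)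
have eig n f : associated_eigenpoly E H n f ->
    monic_eigenpoly H (- at_one (remainder H)) n f.
  case=> h [lambda [[_ HE _]]]; suff -> : - at_one (remainder H) = lambda by [].
  by apply: (H_op_lambda_inj (g := g) (h := h)); rewrite -HE -recovered_H_op.
do 5?split => //.
- by exists g; split=> // h; apply: recovered_inj gH.
- move=> h /par hp; exists (- at_one (remainder H)); split=> // mu [_ HE _].
  by apply: (H_op_lambda_inj (g := h) (h := h)); rewrite -HE; case: hp.
- move=> n.
  have [f fE] := eigenpoly_exists charK0 (- at_one (remainder H)) n Lg.
  have HE := recovered_H_op gH; exists f; split.
    by exists g, (- at_one (remainder H)); split; [exact: par | rewrite {1}HE].
  move=> t /eig; rewrite {1}HE; exact: eigenpoly_unique fE.
- have [p [q [c gE]]] := is_laurentE Lg.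
  by exists p, q, c; rewrite -gE.
move=> p q c rH n f /eig; rewrite {1}(recovered_H_op rH).
exact: eigenpoly_spectral.
Qed.
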